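(* Let $A,B,C$ be real matrices of sizes $n\times n$, $n\times r$, $l\times n$ with $\operatorname{rank}B=r$. Let $\nu=n/r$ be the controllability index of $(A,B)$. If the pair $(A,B)$ is completely controllable and the pair $(A,C)$ is completely observable, then the matrix polynomials $C(s)=C_1+C_2s+\cdots+C_\nu s^{\nu-1}$ and $A_2^*(s)=T_\nu+T_{\nu-1}s+\cdots+T_1s^{\nu-1}+I_rs^\nu$, constructed from the block companion (Asseo) canonical form of the system as in the context, are relatively right prime.
   Context: The controllability index of $(A,B)$ is the smallest integer $\nu$ with $\operatorname{rank}[B,AB,\dots,A^{\nu-1}B]=\operatorname{rank}[B,AB,\dots,A^{n-1}B]$. When $(A,B)$ is controllable and $n=r\nu$, define $N_\nu=[O,\dots,O,I_r]\,[B,AB,\dots,A^{\nu-1}B]^{-1}$ ($r\times n$) and let $N$ be the nonsingular $n\times n$ matrix with block rows $N_\nu,N_\nu A,\dots,N_\nu A^{\nu-1}$ (from top to bottom). Then $NB=\begin{bmatrix}O\\ I_r\end{bmatrix}$ and $$NAN^{-1}=\begin{bmatrix}O&I_r&O&\cdots&O\\O&O&I_r&\cdots&O\\ \vdots&&&\ddots&\vdots\\O&O&O&\cdots&I_r\\-T_\nu&-T_{\nu-1}&-T_{\nu-2}&\cdots&-T_1\end{bmatrix}$$ with $r\times r$ blocks, which defines $T_1,\dots,T_\nu$. The $l\times r$ matrices $C_i$ are defined by $CN^{-1}=[C_1,\dots,C_\nu]$. A square polynomial matrix $D(s)$ is a common right divisor of polynomial matrices $X(s),Y(s)$ if $X=X_1D$,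 $Y=Y_1D$ for some polynomial matrices $X_1,Y_1$; it is a greatest common right divisor if moreover every common right divisor $D'$ satisfies $D=QD'$ for some polynomial matrix $Q$. $X(s),Y(s)$ are relatively right prime if a greatest common right divisor of them is unimodular (square polynomial matrix with nonzero constant determinant). *)

(* Defs.v *)
From HB Require Import structures.
From mathcomp Require Import all_boot all_order all_algebra.
From mathcomp Require Import reals.
Set Implicit Arguments.
Unset Strict Implicit.
Unset Printing Implicit Defensive.
Import Order.TTheory GRing.Theory Num.Theory.
Local Open Scope ring_scope.

(* Width of a matrix made of nu blocks of width r; used to move between
   'M_n and the block-indexed types of \mxrow and \mxcol. *)
Lemma sum_blocks (n r nu : nat) : n = (r * nu)%N -> (\sum_(i < nu) r)%N = n.
Proof. by move->; rewrite sum_nat_const card_ord mulnC. Qed.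

Section Pairs.
Variables (R : realType) (n r l : nat).
Implicit Types (A : 'M[R]_n) (B : 'M[R]_(n, r)) (C : 'M[R]_(l, n)).

(* [B, AB, ..., A^(k-1)B] *)
Definition ctrb_mx A B (k : nat) : 'M[R]_(n, \sum_(i < k) r) :=
  \mxrow_(i < k) (A ^+ i *m B).

(* the block column C, CA, ..., CA^(k-1) *)
Definition obsv_mx A C (k : nat) : 'M[R]_(\sum_(i < k) l, n) :=
  \mxcol_(i < k) (C *m A ^+ i).

Definition completely_controllable A B : Prop := \rank (ctrb_mx A B n) = n.

Definition completely_observable A C : Prop := \rank (obsv_mx A C n) = n.

Definition is_controllability_index A B (nu : nat) : Prop :=
  \rank (ctrb_mx A B nu) = \rank (ctrb_mx A B n) /\
  forall k : nat,
    \rank (ctrb_mx A B k) = \rank (ctrb_mx A B n) -> (nu <= k)%N.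

End Pairs.

Section BlockCompanion.
Variables (R : realType) (n r l nu : nat) (hn : n = (r * nu)%N).
Variables (A : 'M[R]_n) (B : 'M[R]_(n, r)) (C : 'M[R]_(l, n)).

(* [O, ..., O, I_r] *)
Definition last_block : 'M[R]_(r, n) :=
  castmx (erefl r, sum_blocks hn)
    (\mxrow_(j < nu) (if j.+1 == nu then 1%:M else 0 : 'M[R]_r)).

Definition asseo_last : 'M[R]_(r, n) :=
  last_block *m invmx (castmx (erefl n, sum_blocks hn) (ctrb_mx A B nu)).

Definition asseo_mx : 'M[R]_n :=
  castmx (sum_blocks hn, erefl n) (\mxcol_(i < nu) (asseo_last *m A ^+ i)).

(* j-th (from 0) of the nu consecutive blocks of width r of a matrix with
   n = r * nu columns *)
Definition block_col (m : nat) (X : 'M[R]_(m, n)) (j : 'I_nu) : 'M[R]_(m, r) :=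
  submxrow (castmx (erefl m, esym (sum_blocks hn)) X) j.

(* T_(i+1).  The last block row of N A N^-1, obtained by multiplying on the
   left by [O, ..., O, I_r], is [-T_nu, ..., -T_1]. *)
Definition asseo_T (i : 'I_nu) : 'M[R]_r :=
  - block_col (last_block *m (asseo_mx *m A *m invmx asseo_mx)) (rev_ord i).

(* C_(i+1) *)
Definition asseo_C (i : 'I_nu) : 'M[R]_(l, r) :=
  block_col (C *m invmx asseo_mx) i.

(* C_1 + C_2 s + ... + C_nu s^(nu-1) *)
Definition C_poly : 'M[{poly R}]_(l, r) :=
  \sum_(j < nu) 'X^j *: map_mx polyC (asseo_C j).

(* T_nu + T_(nu-1) s + ... + T_1 s^(nu-1) + I_r s^nu; the coefficient of s^j is
   T_(nu-j), and rev_ord j has value nu-j-1. *)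
Definition A2star_poly : 'M[{poly R}]_r :=
  \sum_(j < nu) 'X^j *: map_mx polyC (asseo_T (rev_ord j)) + 'X^nu *: 1%:M.

End BlockCompanion.

Section RightPrime.
Variables (R : realType) (m1 m2 p : nat).
Variables (X : 'M[{poly R}]_(m1, p)) (Y : 'M[{poly R}]_(m2, p)).

Definition common_right_divisor (D : 'M[{poly R}]_p) : Prop :=
  (exists X1 : 'M[{poly R}]_(m1, p), X = X1 *m D) /\
  (exists Y1 : 'M[{poly R}]_(m2, p), Y = Y1 *m D).

Definition greatest_common_right_divisor (D : 'M[{poly R}]_p) : Prop :=
  common_right_divisor D /\
  forall D' : 'M[{poly R}]_p, common_right_divisor D' ->
    exists Q : 'M[{poly R}]_p, D = Q *m D'.

Definition unimodular (D : 'M[{poly R}]_p) : Prop :=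
  exists2 c : R, c != 0 & \det D = c%:P.

Definition relatively_right_prime : Prop :=
  exists2 D : 'M[{poly R}]_p, greatest_common_right_divisor D & unimodular D.

End RightPrime.

(* Main.v *)
Require Import Defs.
From HB Require Import structures.
From mathcomp Require Import all_boot all_order all_algebra.
From mathcomp Require Import reals.
Set Implicit Arguments.
Unset Strict Implicit.
Unset Printing Implicit Defensive.
Import Order.TTheory GRing.Theory Num.Theory.
Local Open Scope ring_scope.

(** Let [S(s)] be the block column [I, sI, ..., s^(nu-1) I] and [W = N^-1 S].
    The block companion form says [(sI - A) W = N^-1 [O; ...; O; I] A2*(s)],
    while [C(s) = C W].  Hence [A^k W = s^k W] modulo left multiples of
    [A2*(s)].  By observability [sum_k L_k C A^k = I] for some constant [L_k],
    so [W = U C(s) + V A2*(s)] with [U], [V] polynomial; the first block row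
    of [N W = S] is [I], which gives a Bezout identity for [C(s), A2*(s)]. *)

(** * Block rows and columns of the identity *)

Section BlockUnits.
Variables (K : pzRingType) (n r m : nat) (e : (\sum_(i < m) r)%N = n).

(** Products with [unit_col] and [unit_row] extract blocks, which confines the casts along [e] to
    this section. *)
Definition unit_col (j : 'I_m) : 'M[K]_(n, r) :=
  submxrow (castmx (erefl n, esym e) 1%:M) j.

Definition unit_row (i : 'I_m) : 'M[K]_(r, n) :=
  submxcol (castmx (esym e, erefl n) 1%:M) i.

Lemma mul_unit_col p (X : 'M[K]_(p, n)) (j : 'I_m) :
  X *m unit_col j = submxrow (castmx (erefl p, esym e) X) j.
Proof.
by rewrite /unit_col; case: n / e X => X; rewrite !castmx_id mul_submxrow mulmx1.
Qed.

Lemma mul_mxrow_unit_col p (B : 'I_m -> 'M[K]_(p, r)) (j : 'I_m) :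
  castmx (erefl p, e) (\mxrow_i B i) *m unit_col j = B j.
Proof.
by rewrite /unit_col; case: n / e; rewrite !castmx_id mul_submxrow mulmx1 mxrowK.
Qed.

Lemma mul_unit_row_mxcol p (B : 'I_m -> 'M[K]_(r, p)) (i : 'I_m) :
  unit_row i *m castmx (e, erefl p) (\mxcol_j B j) = B i.
Proof.
by rewrite /unit_row; case: n / e; rewrite !castmx_id submxcol_mul mul1mx mxcolK.
Qed.

Lemma sum_unit_col_row : \sum_i unit_col i *m unit_row i = 1%:M.
Proof.
rewrite /unit_col /unit_row; case: n / e; rewrite !castmx_id.
by rewrite -mul_mxrow_mxcol submxrowK submxcolK mulmx1.
Qed.

Lemma unit_rowE (i : 'I_m) :
  unit_row i =
  castmx (erefl r, e) (\mxrow_j (if j == i then 1%:M else 0 : 'M[K]_r)).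
Proof.
rewrite /unit_row; case: n / e; rewrite !castmx_id.
apply/mxrowP => j; rewrite mxrowK.
(* Two flattened indices agree exactly when both the block numbers and the offsets agree. *)
apply/matrixP => x y; rewrite !mxE -val_eqE /= tagnat.eq_Rank.
by case: eqVneq => _ /=; rewrite !mxE.
Qed.

Lemma unit_row_col (i j : 'I_m) :
  unit_row i *m unit_col j = if j == i then 1%:M else 0.
Proof. by rewrite unit_rowE mul_mxrow_unit_col. Qed.

Lemma unit_row_inj p (X Y : 'M[K]_(n, p)) :
  (forall i, unit_row i *m X = unit_row i *m Y) -> X = Y.
Proof.
move=> XY; rewrite -[X]mul1mx -[Y]mul1mx -sum_unit_col_row !mulmx_suml.
by apply: eq_bigr => i _; rewrite -!mulmxA XY.
Qed.

End BlockUnits.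

(** * From observability to a Bezout identity *)

Lemma exprmx_eigen_mod (K : comPzRingType) (n r p : nat) (x : K)
    (A : 'M[K]_n) (W : 'M[K]_(n, r)) (E : 'M[K]_(n, p)) (D : 'M[K]_(p, r)) :
  x *: W - A *m W = E *m D ->
  forall k, exists G, A ^+ k *m W = x ^+ k *: W + G *m D.
Proof.
move=> AW; have {}AW : A *m W = x *: W - E *m D by rewrite -AW opprB addrC subrK.
elim=> [|k [G IH]].
  by exists 0; rewrite mul0mx addr0 scale1r mul1mx.
(* Multiply [x ^+ k *: W + G *m D] by [A] and replace [A *m W] by [x *: W - E *m D]. *)
exists (A *m G - x ^+ k *: E).
rewrite exprS -mulmxA IH mulmxDr -scalemxAr AW scalerBr scalerA -exprSr.
by rewrite mulmxBl -mulmxA -scalemxAl -addrA [- _ + _]addrC.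
Qed.

Lemma observable_bezout (R : realType) (n r l p : nat)
    (A : 'M[R]_n) (C : 'M[R]_(l, n))
    (W : 'M[{poly R}]_(n, r)) (E : 'M[{poly R}]_(n, p))
    (D : 'M[{poly R}]_(p, r)) :
  completely_observable A C ->
  'X *: W - map_mx polyC A *m W = E *m D ->
  exists U V, W = U *m (map_mx polyC C *m W) + V *m D.
Proof.
move=> obsAC AW.
(* Full column rank gives a constant left inverse [L], whose block columns are the [L_k]. *)
have /row_fullP [L LO] : row_full (obsv_mx A C n) by rewrite /row_full obsAC.
have {}LO : \sum_(k < n) submxrow L k *m (C *m A ^+ k) = 1%:M.
  by rewrite -mul_mxrow_mxcol submxrowK.
have step (k : 'I_n) : exists UV : 'M_(n, l) * 'M_(n, p),
    map_mx polyC (submxrow L k *m (C *m A ^+ k)) *m W =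
    UV.1 *m (map_mx polyC C *m W) + UV.2 *m D.
  have [G AkW] := exprmx_eigen_mod AW k.
  (* With [G] as above, the left side is [L_k C (s^k W + G D)]. *)
  exists ('X ^+ k *: map_mx polyC (submxrow L k),
          map_mx polyC (submxrow L k) *m map_mx polyC C *m G) => /=.
  rewrite !map_mxM rmorphXn /= -!mulmxA AkW !mulmxDr.
  by rewrite -!scalemxAr -!scalemxAl.
have [UV UVE] := fin_all_exists step.
exists (\sum_k (UV k).1), (\sum_k (UV k).2).
rewrite -[LHS]mul1mx -(map_mx1 polyC) -LO map_mx_sum !mulmx_suml -big_split /=.
exact: eq_bigr.
Qed.

(** A common right divisor of [X] and [Y] also divides [U *m X + V *m Y], so the identity is a
    greatest one. *)
Lemma bezout_right_prime (R : realType) (m1 m2 p : nat)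
    (X : 'M[{poly R}]_(m1, p)) (Y : 'M[{poly R}]_(m2, p))
    (U : 'M[{poly R}]_(p, m1)) (V : 'M[{poly R}]_(p, m2)) :
  U *m X + V *m Y = 1%:M -> relatively_right_prime X Y.
Proof.
move=> bezout; exists 1%:M; last by exists 1; rewrite ?oner_eq0 // det1.
split; first by split; [exists X | exists Y]; rewrite mulmx1.
move=> D [[X1 XE] [Y1 YE]]; exists (U *m X1 + V *m Y1).
by rewrite mulmxDl -!mulmxA -XE -YE.
Qed.

(** * Invertibility of the Asseo matrix *)

Section BlockCompanionForm.
Variables (R : realType) (n r m : nat) (hn : n = (r * m.+1)%N).
Variables (A : 'M[R]_n) (B : 'M[R]_(n, r)).
Hypothesis ctrb_full : \rank (ctrb_mx A B m.+1) = n.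

Local Notation e := (sum_blocks hn).
Local Notation ecol := (unit_col R e).
Local Notation erow := (unit_row R e).
Local Notation N := (asseo_mx hn A B).
Local Notation Nlast := (asseo_last hn A B).

Lemma last_blockE : last_block R hn = erow ord_max.
Proof. by rewrite unit_rowE. Qed.

(** [Nlast] times the controllability matrix is [[O, ..., O, I]] by construction; this reads off its
    blocks. *)
Lemma asseo_last_ctrb (j : 'I_m.+1) :
  Nlast *m (A ^+ j *m B) = if j == ord_max then 1%:M else 0.
Proof.
rewrite -(mul_mxrow_unit_col e (fun i : 'I_m.+1 => A ^+ i *m B)).
rewrite /asseo_last -/(ctrb_mx A B m.+1) !mulmxA mulmxKV.
  by rewrite last_blockE unit_row_col.
rewrite -row_free_unit /row_free; apply/eqP.
by case: n / (e) A B ctrb_full.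
Qed.

Lemma row_asseo_mx i : erow i *m N = Nlast *m A ^+ i.
Proof. exact: mul_unit_row_mxcol. Qed.

(* Right multiplication by [A^(m-i) B] annihilates the rows of [N] above the
   [i]-th and maps the [i]-th to the identity, so the blocks of a vector in the
   left kernel vanish one after the other, starting from the last one. *)
Lemma asseo_unitmx : N \in unitmx.
Proof.
rewrite -row_free_unit; apply: inj_row_free => v vN0.
have vE : v = \sum_i v *m ecol i *m erow i.
  by under eq_bigr do rewrite -mulmxA; rewrite -mulmx_sumr sum_unit_col_row mulmx1.
suff v0 k (i : 'I_m.+1) : (m - i <= k)%N -> v *m ecol i = 0.
  by rewrite vE big1 // => i _; rewrite (v0 m) ?leq_subr ?mul0mx.
elim/ltn_ind: k i => k IH i le_ik.
have : v *m N *m (A ^+ (m - i) *m B) = 0 by rewrite vN0 mul0mx.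
rewrite [in v *m N]vE !mulmx_suml (bigD1 i) //= big1 => [|j ne_ji]; last first.
  rewrite -!(mulmxA (v *m _)) row_asseo_mx.
  have [lt_ij|le_ji] := ltnP i j.
    rewrite (IH (m - j)%N _ j) ?mul0mx //.
    apply: leq_trans le_ik; apply: ltn_sub2l => //.
    by apply: leq_trans lt_ij _; rewrite -ltnS.
  have lt_ji : (j < i)%N by rewrite ltn_neqAle le_ji andbT.
  have lt_m : (j + (m - i) < m)%N.
    by rewrite -[ltnRHS](subnKC (leq_ord i)) ltn_add2r.
  rewrite -(mulmxA Nlast) (mulmxA (A ^+ j)) -[A ^+ j *m _]exprD.
  rewrite (asseo_last_ctrb (Ordinal (ltnW lt_m : _ < m.+1)%N)).
  by rewrite ifN ?mulmx0 // -val_eqE /= neq_ltn lt_m.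
rewrite addr0 -!(mulmxA (v *m _)) row_asseo_mx.
rewrite -(mulmxA Nlast) (mulmxA (A ^+ i)) -[A ^+ i *m _]exprD subnKC ?leq_ord //.
by rewrite (asseo_last_ctrb ord_max) eqxx mulmx1.
Qed.

(** Source of the shifted identity blocks: [widen_ord] ranges over all block rows but the last,
    [lift ord0] over their successors. *)
Lemma row_asseo_shift (i : 'I_m) :
  erow (widen_ord (leqnSn m) i) *m (N *m A) = erow (lift ord0 i) *m N.
Proof. by rewrite mulmxA !row_asseo_mx -mulmxA -[A ^+ _ *m A]exprSr. Qed.

(** * The companion matrix and its polynomial identities *)

Local Notation M := (N *m A *m invmx N).
Local Notation T := (asseo_T hn A B).
Local Notation last_col := (ecol ord_max).

Lemma row_companion_max (j : 'I_m.+1) :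
  erow ord_max *m (M *m ecol j) = - T (rev_ord j).
Proof.
rewrite /asseo_T opprK rev_ordK /block_col -mul_unit_col last_blockE.
by rewrite -(mulmxA (erow _)).
Qed.

Lemma row_companion_widen (i : 'I_m) (j : 'I_m.+1) :
  erow (widen_ord (leqnSn m) i) *m (M *m ecol j) =
  if j == lift ord0 i then 1%:M else 0.
Proof.
by rewrite 2!mulmxA row_asseo_shift mulmxK ?asseo_unitmx // unit_row_col.
Qed.

(** The companion form is needed by columns, since [state_poly] attaches the power ['X^j] to block
    column [j]. *)
Lemma companion_col0 : M *m ecol ord0 = - (last_col *m T (rev_ord ord0)).
Proof.
apply: (unit_row_inj (e := e)) => k; rewrite mulmxN (mulmxA (erow k)) unit_row_col.
case: (unliftP ord_max k) => [i|] ->.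
  have -> : lift ord_max i = widen_ord (leqnSn m) i by apply/val_inj/lift_max.
  rewrite row_companion_widen (negPf (neq_lift _ _)) ifN ?mul0mx ?oppr0 //.
  by rewrite -val_eqE /= neq_ltn ltn_ord orbT.
by rewrite row_companion_max eqxx mul1mx.
Qed.

Lemma companion_col_lift (i : 'I_m) :
  M *m ecol (lift ord0 i) =
  ecol (widen_ord (leqnSn m) i) - last_col *m T (rev_ord (lift ord0 i)).
Proof.
apply: (unit_row_inj (e := e)) => k.
rewrite mulmxBr (mulmxA (erow k)) !unit_row_col.
case: (unliftP ord_max k) => [k'|] ->.
  have -> : lift ord_max k' = widen_ord (leqnSn m) k' by apply/val_inj/lift_max.
  rewrite row_companion_widen (inj_eq lift_inj) [if ord_max == _ then _ else _]ifN.
    by rewrite mul0mx subr0 -!val_eqE.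
  by rewrite -val_eqE /= neq_ltn ltn_ord orbT.
rewrite row_companion_max eqxx mul1mx ifN ?sub0r //.
by rewrite -val_eqE /= neq_ltn ltn_ord.
Qed.

(** This is [W = N^-1 S(s)], expanded in powers of [s]. *)
Definition state_poly : 'M[{poly R}]_(n, r) :=
  \sum_(j < m.+1) 'X^j *: map_mx polyC (invmx N *m ecol j).

Lemma C_polyE l (C : 'M[R]_(l, n)) :
  C_poly hn A B C = map_mx polyC C *m state_poly.
Proof.
rewrite mulmx_sumr; apply: eq_bigr => j _.
by rewrite -scalemxAr -map_mxM mulmxA mul_unit_col.
Qed.

(** The sum telescopes: the shift part of [A] on the term of degree [j+1] cancels [s] times the term
    of degree [j]. What survives is the top power and the [T] terms, all carried by [last_col]. *)
Lemma A2star_polyE :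
  'X *: state_poly - map_mx polyC A *m state_poly =
  map_mx polyC (invmx N *m last_col) *m A2star_poly hn A B.
Proof.
have AN (j : 'I_m.+1) : A *m (invmx N *m ecol j) = invmx N *m (M *m ecol j).
  by rewrite !mulmxA mulVmx ?asseo_unitmx // mul1mx.
rewrite scaler_sumr mulmx_sumr /A2star_poly mulmxDr mulmx_sumr.
under eq_bigr do rewrite scalerA -exprS.
(* Isolate the unmatched terms: the top power in the first sum, column 0 in the others. *)
rewrite big_ord_recr [X in - X]big_ord_recl [X in _ = X + _]big_ord_recl /=.
under [X in _ - (_ + X)]eq_bigr => i _ do
  rewrite -scalemxAr -map_mxM AN companion_col_lift mulmxBr map_mxB scalerBr.
under [X in _ = _ + X + _]eq_bigr => i _ do
  rewrite -scalemxAr -map_mxM -mulmxA.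
rewrite sumrB -!scalemxAr -!map_mxM AN companion_col0 mulmxN.
rewrite map_mxN scalerN mulmx1 -mulmxA !opprD !opprK.
by rewrite [- _ + _]addrC [LHS]addrC !addrA subrK.
Qed.

Lemma asseo_state_poly :
  map_mx polyC (erow ord0 *m N) *m state_poly = 1%:M.
Proof.
rewrite mulmx_sumr big_ord_recl big1 => [|i _].
  rewrite expr0 scale1r addr0 -map_mxM -mulmxA mulKVmx ?asseo_unitmx //.
  by rewrite unit_row_col eqxx map_mx1.
rewrite -scalemxAr -map_mxM -mulmxA mulKVmx ?asseo_unitmx //.
by rewrite unit_row_col /= map_mx0 scaler0.
Qed.

End BlockCompanionForm.

Theorem theorem4p1 (R : realType) (n r l nu : nat)
    (A : 'M[R]_n) (B : 'M[R]_(n, r)) (C : 'M[R]_(l, n))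
    (hr : (0 < r)%N) (hB : \rank B = r)
    (hn : n = (r * nu)%N) (hnu : is_controllability_index A B nu)
    (hctrb : completely_controllable A B)
    (hobsv : completely_observable A C) :
  relatively_right_prime (C_poly hn A B C) (A2star_poly hn A B).
Proof.
case: nu hn hnu => [|m] hn [rank_nu _].
  (* For [nu = 0] the state space is trivial, contradicting [0 < r = \rank B <= n]. *)
  have : (r <= n)%N by rewrite -{1}hB rank_leq_row.
  by rewrite [X in (_ <= X)%N]hn muln0 leqNgt hr.
have ctrb_full : \rank (ctrb_mx A B m.+1) = n by rewrite rank_nu.
have [U [V WE]] := observable_bezout hobsv (A2star_polyE hn ctrb_full).
(* Multiplying [W = U C(s) + V A2*(s)] on the left by the first block row of [N] turns its left side
   into the identity. *)
have := asseo_state_poly hn ctrb_full; rewrite WE -C_polyE mulmxDr !mulmxA.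
exact: bezout_right_prime.
Qed.
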